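(* Let $(M,F)$ be a conic pseudo-Finsler surface with $F$ defined on the conic sub-bundle $\mathcal A$, let $\phi:\mathcal A\to\mathbb R$ be a smooth function positively homogeneous of degree $0$ in $y$ with $\sigma+\varepsilon-(\phi_{;2})^2\neq0$ on $\mathcal A$, where $\sigma=\phi_{;2;2}+\varepsilon\mathcal I\phi_{;2}+2(\phi_{;2})^2$, and let $\overline F=e^{\phi}F$. Then the following assertions are equivalent (each for all values of the indices): (i) $\overline G^i=G^i$; (ii) $\overline G^i_j=G^i_j$; (iii) $\overline G^i_{jk}=G^i_{jk}$.
   Context: Let $M$ be a smooth 2-dimensional manifold, $(x^1,x^2)$ local coordinates and $(x^i,y^i)$ the induced coordinates on $TM$; all formulas are in such a coordinate system and repeated indices are summed over $\{1,2\}$. Write $\partial_i=\partial/\partial x^i$, $\dot\partial_i=\partial/\partial y^i$. A conic sub-bundle is a non-empty open subset $\mathcal A\subset TM\setminus 0$ projecting onto $M$ and closed under multiplication by positive scalars. A conic pseudo-Finsler metric on $M$ is a smooth function $F:\mathcal A\to\mathbb R$, positively homogeneous of degree one in $y$, such that $g_{ij}=\tfrac12\dot\partial_i\dot\partial_jF^2$ is non-degenerate at each point of $\mathcal A$; $(g^{ij})$ is the inverse matrix. A conic pseudo-Finsler surface is equipped with its modified Berwald frame: $F$ is nowhere zero on $\mathcal A$, $\ell_i=\dot\partial_iF$, $\ell^i=y^i/F$, $\varepsilon\in\{1,-1\}$ (the signature) is the sign of $\det(g_{ij})$, $m_1=-\sqrt{\varepsilon\det(g_{ij})}\,\ell^2$,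 $m_2=\sqrt{\varepsilon\det(g_{ij})}\,\ell^1$, $m^i=g^{ij}m_j$. The main scalar $\mathcal I$ is defined by $F\,C_{ijk}=\mathcal I\,m_im_jm_k$, where $C_{ijk}=\tfrac12\dot\partial_kg_{ij}$. For a smooth function $f$ on $\mathcal A$, $f_{;2}:=\varepsilon F(\dot\partial_if)m^i$ and $f_{;2;2}:=(f_{;2})_{;2}$. The geodesic spray coefficients of $F$ are $G^i=\tfrac14g^{ij}(y^k\dot\partial_j\partial_kF^2-\partial_jF^2)$; the Barthel connection has coefficients $G^i_j=\dot\partial_jG^i$ and the Berwald connection has coefficients $G^i_{jk}=\dot\partial_kG^i_j$. Barred versions are defined in the same way from $\overline F$ (the condition $\sigma+\varepsilon-(\phi_{;2})^2\ne0$ guarantees that $\overline F$ is a conic pseudo-Finsler metric). *)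

(* Defs.v *)
From mathcomp Require Import all_boot all_order all_algebra.
From mathcomp Require Import all_classical all_reals all_analysis.
Set Implicit Arguments.
Unset Strict Implicit.
Unset Printing Implicit Defensive.
Import Order.TTheory GRing.Theory Num.Theory.
Import numFieldNormedType.Exports.
Local Open Scope classical_set_scope.
Local Open Scope ring_scope.

(* C^oo on an open set: all iterated directional derivatives exist and are
   continuous (V is used only in finite dimension).  Functions are total; only
   their values on A matter. *)
Definition smooth_on (R : realType) (V W : normedModType R)
    (A : set V) (f : V -> W) : Prop :=
  forall (s : seq V) (z : V), A z ->
    let h := foldr (fun v k => 'D_v k) f s in
    {for z, continuous h} /\ (forall v, derivable h z v).

(* Maps between charts are total functions, meaningful on the chart domains
   only. *)
Record surface (R : realType) := Surface {
  pt :> topologicalType;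
  chart : Type;
  dom : chart -> set pt;
  coord : chart -> pt -> 'rV[R]_2;
  coordV : chart -> 'rV[R]_2 -> pt;
  chart_at : pt -> chart;
  surface_hausdorff : hausdorff_space pt;
  surface_second_countable : @second_countable pt;
  dom_open : forall a, open (dom a);
  dom_chart_at : forall p, dom (chart_at p) p;
  coord_open : forall a, open (coord a @` dom a);
  coordK : forall a p, dom a p -> coordV a (coord a p) = p;
  coord_continuous : forall a p, dom a p -> {for p, continuous (coord a)};
  coordV_continuous : forall a x, (coord a @` dom a) x ->
    {for x, continuous (coordV a)};
  coord_smooth : forall a b,
    smooth_on (coord a @` (dom a `&` dom b)) (coord b \o coordV a)
}.

Section TangentBundle.
Variables (R : realType) (M : surface R).

Definition transition (a b : chart M) : 'rV[R]_2 -> 'rV[R]_2 :=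
  coord b \o coordV a.

(* A tangent vector at p is given by its components in the chart chart_at p. *)
Definition tangent : Type := (M * 'rV[R]_2)%type.

Definition tscale (t : R) (u : tangent) : tangent := (u.1, t *: u.2).

(* The tangent vector with induced coordinates z = (x, y) in the chart a. *)
Definition tpoint (a : chart M) (z : 'rV[R]_2 * 'rV[R]_2) : tangent :=
  let p := coordV a z.1 in (p, 'd (transition a (chart_at p)) (z.1) z.2).

Definition local (f : tangent -> R) (a : chart M) :
  'rV[R]_2 * 'rV[R]_2 -> R := f \o tpoint a.

Definition local_dom (A : set tangent) (a : chart M) :
    set ('rV[R]_2 * 'rV[R]_2) :=
  [set z | (coord a @` dom a) z.1 /\ A (tpoint a z)].

Definition conic_subbundle (A : set tangent) : Prop :=
  [/\ A !=set0,
      (forall a, open (local_dom A a)),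
      (forall u, A u -> u.2 != 0),
      (forall p : M, exists u, A u /\ u.1 = p)
    & (forall u t, A u -> 0 < t -> A (tscale t u))].

Definition tsmooth (A : set tangent) (f : tangent -> R) : Prop :=
  forall a, smooth_on (local_dom A a) (local f a).

Definition homogeneous (k : nat) (A : set tangent) (f : tangent -> R) : Prop :=
  forall u t, A u -> 0 < t -> f (tscale t u) = t ^+ k * f u.

End TangentBundle.

Section Coordinates.
Variable R : realType.
Local Notation TR2 := ('rV[R]_2 * 'rV[R]_2)%type.
Implicit Types (F f : TR2 -> R) (z : TR2) (i j k : 'I_2).

(* Coordinate indices 1, 2 are encoded as 0, 1 : 'I_2. *)
Definition yc (i : 'I_2) (z : TR2) : R := z.2 0 i.

Definition dx (i : 'I_2) (f : TR2 -> R) : TR2 -> R :=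
  'D_((delta_mx 0 i, 0) : TR2) f.

Definition dy (i : 'I_2) (f : TR2 -> R) : TR2 -> R :=
  'D_((0, delta_mx 0 i) : TR2) f.

Definition sq F : TR2 -> R := fun z => F z ^+ 2.

Definition metric F z : 'M[R]_2 :=
  \matrix_(i, j) (2^-1 * dy i (dy j (sq F)) z).

Definition metric_inv F z : 'M[R]_2 := invmx (metric F z).

Definition cartan F i j k z : R := 2^-1 * dy k (fun w => metric F w i j) z.

Definition ell_up F i z : R := yc i z / F z.

(* The sign is taken pointwise, so det g may have different signs on different
   components of the domain. *)
Definition signature F z : R := Num.sg (\det (metric F z)).

Definition m_lo F i z : R :=
  let s := Num.sqrt (signature F z * \det (metric F z)) in
  if i == 0 then - s * ell_up F 1 z else s * ell_up F 0 z.

Definition m_up F i z : R := \sum_j metric_inv F z i j * m_lo F j z.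

(* The unique I with F C_ijk = I m_i m_j m_k; unique since m != 0, and it exists
   since C is totally symmetric and C_ijk y^k = 0. *)
Definition main_scalar F z : R :=
  xget 0 [set I | forall i j k,
    F z * cartan F i j k z = I * m_lo F i z * m_lo F j z * m_lo F k z].

(* f_{;2} *)
Definition d2 F f : TR2 -> R :=
  fun z => signature F z * F z * \sum_i dy i f z * m_up F i z.

Definition sigma F f z : R :=
  d2 F (d2 F f) z + signature F z * main_scalar F z * d2 F f z
  + 2 * d2 F f z ^+ 2.

Definition spray F i : TR2 -> R := fun z =>
  4^-1 * \sum_j metric_inv F z i j *
    ((\sum_k yc k z * dy j (dx k (sq F)) z) - dx j (sq F) z).

Definition barthel F i j : TR2 -> R := dy j (spray F i).

Definition berwald F i j k : TR2 -> R := dy k (barthel F i j).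

End Coordinates.

Definition conic_pseudo_Finsler (R : realType) (M : surface R)
    (A : set (tangent M)) (F : tangent M -> R) : Prop :=
  [/\ conic_subbundle A, tsmooth A F, homogeneous 1 A F
    & forall a z, local_dom A a z -> \det (metric (local F a) z) != 0].

Definition conformal_change (R : realType) (M : surface R)
    (F phi : tangent M -> R) : tangent M -> R := fun u => expR (phi u) * F u.

(* Main.v *)
Require Import Defs.
From mathcomp Require Import all_boot all_order all_algebra.
From mathcomp Require Import all_classical all_reals all_analysis.
From mathcomp Require Import ring lra.
Import Order.TTheory GRing.Theory Num.Theory.
Import numFieldNormedType.Exports.
Local Open Scope classical_set_scope.
Local Open Scope ring_scope.

(* (i) => (ii) => (iii) holds because equal functions on an open set have equal
   derivatives.  Conversely the spray and Barthel coefficients are positively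
   homogeneous in y, of degrees 2 and 1, so Euler's theorem recovers them from
   their y-derivatives.  This needs the spray of Fbar to be smooth, i.e.
   gbar to be non-degenerate.  With n = (-y2, y1), the homogeneity relations
   force g_ij = ell_i ell_j + k n_i n_j, phi_i = c n_i,
   phi_ij = u n_i n_j - (c / F) (n_i ell_j + ell_i n_j), and the definition of the
   main scalar gives the logarithmic derivative of det g as a multiple of n_k;
   with these normal forms
     det gbar = e^(4 phi) |det g| (sigma + eps - (phi_;2)^2). *)

(** * Directional derivatives and a calculus of smooth real functions on an open set *)

Section Directional.
Context {R : realType} {V : normedModType R}.
Implicit Types (f g : V -> R) (x v : V) (A : set V).

(** Since [h *: v + (t *: v + x)] is [(h + t) *: v + x], both difference quotients are the same
    function of [h]. This reduces chain rules and the mean value theorem to one real variable. *)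
Lemma is_derive_line f x v (t df : R) :
  is_derive (t *: v + x) v f df <->
  is_derive t 1 (fun h : R => f (h *: v + x)) df.
Proof.
have E : (fun h : R => h^-1 *: ((f \o shift (t *: v + x)) (h *: v)
                          - f (t *: v + x))) =
    (fun h : R => h^-1 *: (((fun h : R => f (h *: v + x)) \o shift t) (h *: 1)
                          - f (t *: v + x))).
  apply/funext => h /=; congr (_ *: (f _ - _)).
  by rewrite scalerDl addrA [h *: 1]mulr1.
by split=> -[]; rewrite /derivable /derive => H1 H2; split;
  rewrite /derivable /derive; move: H1 H2; rewrite E.
Qed.

Lemma is_derive_line0 f x v (df : R) :
  is_derive x v f df <-> is_derive (0 : R) 1 (fun h : R => f (h *: v + x)) df.
Proof. by have := is_derive_line f x v 0 df; rewrite scale0r add0r. Qed.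

Lemma is_derive_scale_dir f x v (c df : R) :
  is_derive x v f df -> is_derive x (c *: v) f (df * c).
Proof.
move=> /is_derive_line0 H; apply/is_derive_line0.
have E : (fun h : R => f (h *: (c *: v) + x)) =
         (fun h : R => f (h *: v + x)) \o (fun h => h * c).
  by apply/funext => h /=; rewrite scalerA.
rewrite E; apply: is_derive1_comp; first by rewrite mul0r.
have -> : (fun h : R => h * c) = c \*: (@id R).
  by apply/funext => h /=; rewrite mulrC.
by have := @is_deriveZ R R R id c 0 1 1 _; rewrite [c *: 1]mulr1; apply.
Qed.

Lemma is_derive_comp_real f (h : R -> R) x v (a b : R) :
  is_derive x v f a -> is_derive (f x) 1 h b ->
  is_derive x v (fun z => h (f z)) (b * a).
Proof.
move=> /is_derive_line0 H1 H2; apply/is_derive_line0.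
apply: (@is_derive1_comp _ h (fun t : R => f (t *: v + x))) => //.
by rewrite scale0r add0r.
Qed.

Lemma is_derive_invf f x v (df : R) : f x != 0 -> is_derive x v f df ->
  is_derive x v (fun z => (f z)^-1) (- (f x) ^- 2 * df).
Proof.
move=> fx0 [d1 <-]; split; first exact: derivableV.
by rewrite deriveV.
Qed.

Lemma is_derive_mulf f g x v (df dg : R) :
  is_derive x v f df -> is_derive x v g dg ->
  is_derive x v (fun z => f z * g z) (f x * dg + df * g x).
Proof.
move=> H1 H2; rewrite [df * _]mulrC; exact: (@is_deriveM _ _ f g).
Qed.

Lemma is_derive_addf f g x v (df dg : R) :
  is_derive x v f df -> is_derive x v g dg ->
  is_derive x v (fun z => f z + g z) (df + dg).
Proof. exact: is_deriveD. Qed.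

Lemma is_derive_on A f g x v (df : R) : open A -> A x ->
  (forall z, A z -> f z = g z) -> is_derive x v f df -> is_derive x v g df.
Proof.
move=> oA Ax fg; apply: near_eq_is_derive.
by move: (open_nbhs_nbhs (conj oA Ax)); apply: filterS => z /fg.
Qed.

Lemma derive_on A f g x v : open A -> A x ->
  (forall z, A z -> f z = g z) -> 'D_v f x = 'D_v g x.
Proof.
move=> oA Ax fg; apply: near_eq_derive.
by move: (open_nbhs_nbhs (conj oA Ax)); apply: filterS => z /fg.
Qed.

(** The increment along [h *: (u + v)] splits into a step [h *: u] from [x] followed by a step
    [h *: v]. The mean value theorem turns the second quotient into a value of ['D_v f] near [x],
    which tends to ['D_v f x] by continuity. *)
Lemma is_derive_add_dir A f x u v : open A -> A x ->
  derivable f x u -> (forall z, A z -> derivable f z v) ->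
  {for x, continuous ('D_v f)} ->
  is_derive x (u + v) f ('D_u f x + 'D_v f x).
Proof.
move=> oA Ax du dv cv.
suff H : (fun h : R => h^-1 *: ((f \o shift x) (h *: (u + v)) - f x)) @ 0^'
     --> 'D_u f x + 'D_v f x.
  by split; [apply/cvg_ex; eexists; exact: H | apply: cvg_lim => //; exact: H].
have -> : (fun h : R => h^-1 *: ((f \o shift x) (h *: (u + v)) - f x)) =
  (fun h : R => h^-1 *: ((f \o shift x) (h *: u) - f x)
    + h^-1 *: (f (h *: v + (h *: u + x)) - f (h *: u + x))).
  apply/funext => h /=; rewrite -scalerDr; congr (_ *: _).
  rewrite scalerDr (addrC (h *: u)) -addrA.
  set a := f _; set b := f _; set c := f _; ring.
apply: cvgD; first exact: du.
apply/cvgrPdist_lt => e e0.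
have /cvgrPdist_lt /(_ e e0) N1 := cv.
have N2 : \forall z \near x, A z by exact: open_nbhs_nbhs.
have /nbhs_ballP[d /= d0 Hd] : \forall z \near x, A z /\ `|'D_v f x - 'D_v f z| < e.
  by near=> z; split; near: z.
(* For [t] between 0 and 1 the intermediate points lie within [|h| * C] of [x]; the summand 1 keeps
   [C] positive when [u] and [v] vanish. *)
pose C := `|u| + `|v| + 1.
have C0 : 0 < C by rewrite /C ltr_wpDl // addr_ge0.
have hin (h t : R) : `|h| < d / C -> 0 <= t <= 1 ->
  A ((t * h) *: v + (h *: u + x)) /\
  `|'D_v f x - 'D_v f ((t * h) *: v + (h *: u + x))| < e.
  move=> hd /andP[t0 t1]; apply: Hd; rewrite -ball_normE /=.
  rewrite addrA opprD addrCA subrr addr0 normrN.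
  apply: le_lt_trans (_ : `|h| * C < d); last by rewrite -ltr_pdivlMr.
  apply: le_trans (ler_normD _ _) _; rewrite !normrZ (ger0_norm t0).
  rewrite /C !mulrDr mulr1 [X in X <= _]addrC -addrA lerD2l.
  apply: le_trans (_ : `|h| * `|v| <= _); last by rewrite lerDl.
  by apply: ler_wpM2r => //; rewrite ler_piMl.
near=> h.
have h0 : h != 0 by near: h; exact: nbhs_dnbhs_neq.
have hd : `|h| < d / C.
  near: h; apply: dnbhs0_lt; exact: divr_gt0.
(* [g] follows [f] along the second step, from [h *: u + x] at 0 to the endpoint at 1. *)
pose g (t : R) := f (t *: (h *: v) + (h *: u + x)).
have dg (t : R) : 0 <= t <= 1 ->
    is_derive t 1 g ('D_v f ((t * h) *: v + (h *: u + x)) * h).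
  move=> t01; apply/is_derive_line; rewrite scalerA.
  apply: is_derive_scale_dir; apply/derivableP; apply: dv.
  by have [] := hin h t hd t01.
have cg : {within `[0, 1], continuous g}.
  by apply: derivable_within_continuous => t; rewrite in_itv /= => /dg [].
have dg' (t : R) : t \in `]0, 1[ ->
    is_derive t 1 g ('D_v f ((t * h) *: v + (h *: u + x)) * h).
  by rewrite in_itv /= => /andP[t0 t1]; apply: dg; rewrite !ltW.
have [t t01 E] := MVT ltr01 dg' cg.
have t01' : 0 <= t <= 1 by move: t01; rewrite in_itv /= => /andP[/ltW -> /ltW ->].
have -> : f (h *: v + (h *: u + x)) - f (h *: u + x) = g 1 - g 0.
  by rewrite /g scale1r scale0r add0r.
rewrite E subr0 mulr1 [_ *: _]mulrC mulfK //.
by have [] := hin h t hd t01'.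
Unshelve. all: by end_near. Qed.

(** Functions built from smooth ones by the operations occurring in metric and spray. Induction on
    the construction takes the place of Leibniz formulas for iterated derivatives. The last
    constructor is there because the rules for derivatives hold only on [A]. *)
Inductive smooth_closure A : (V -> R) -> Prop :=
| smooth_closure_base f : smooth_on A f -> smooth_closure A f
| smooth_closure_cst c : smooth_closure A (fun=> c)
| smooth_closure_add f g : smooth_closure A f -> smooth_closure A g ->
    smooth_closure A (fun z => f z + g z)
| smooth_closure_mul f g : smooth_closure A f -> smooth_closure A g ->
    smooth_closure A (fun z => f z * g z)
| smooth_closure_inv f : smooth_closure A f -> (forall z, A z -> f z != 0) ->
    smooth_closure A (fun z => (f z)^-1)
| smooth_closure_exp f : smooth_closure A f ->
    smooth_closure A (fun z => expR (f z))
| smooth_closure_eq f g : (forall z, A z -> f z = g z) ->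
    smooth_closure A f -> smooth_closure A g.

Lemma smooth_on_derive A f v : smooth_on A f -> smooth_on A ('D_v f).
Proof.
by move=> sf s z Az; have := sf (rcons s v) z Az; rewrite foldr_rcons.
Qed.

(** The rules of differentiation express ['D_v f] on [A] through the same operations, so the class
    is stable under differentiation; iterating this yields smoothness. *)
Lemma smooth_closure_step A f : open A -> smooth_closure A f ->
  [/\ forall z, A z -> {for z, continuous f},
      forall v z, A z -> derivable f z v
    & forall v, smooth_closure A ('D_v f)].
Proof.
move=> oA; elim=> {f}.
- move=> f sf; split.
  + by move=> z Az; have [] := sf [::] z Az.
  + by move=> v z Az; have [_] := sf [::] z Az.
  + by move=> v; apply/smooth_closure_base/smooth_on_derive.
- move=> c; split=> [z _|v z _|v]; [exact: cst_continuous|exact: derivable_cst|].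
  apply: smooth_closure_eq (smooth_closure_cst A 0) => z _.
  by rewrite derive_cst.
- move=> f g sf [cf df Df] sg [cg dg Dg]; split=> [z Az|v z Az|v].
  + by apply: cvgD; [exact: cf|exact: cg].
  + by apply: derivableD; [exact: df|exact: dg].
  + apply: smooth_closure_eq (smooth_closure_add _ _ _ (Df v) (Dg v)) => z Az.
    by rewrite (@deriveD _ _ _ f g) //; [exact: df|exact: dg].
- move=> f g sf [cf df Df] sg [cg dg Dg]; split=> [z Az|v z Az|v].
  + by apply: cvgM; [exact: cf|exact: cg].
  + by apply: derivableM; [exact: df|exact: dg].
  + apply: smooth_closure_eq (smooth_closure_add _ _ _
      (smooth_closure_mul _ _ _ sf (Dg v)) (smooth_closure_mul _ _ _ sg (Df v))) => z Az.
    by rewrite (@deriveM _ _ f g) //; [exact: df|exact: dg].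
- move=> f sf [cf df Df] f0; split=> [z Az|v z Az|v].
  + by apply: cvgV; [exact: f0|exact: cf].
  + by apply: derivableV; [exact: f0|exact: df].
  + apply: smooth_closure_eq (smooth_closure_mul _ _ _ (smooth_closure_mul _ _ _
      (smooth_closure_cst A (-1)) (smooth_closure_inv _ _
        (smooth_closure_mul _ _ _ sf sf) _)) (Df v)) => z Az.
      by rewrite deriveV ?f0 //; [rewrite mulN1r -expr2|exact: df].
    by rewrite mulf_neq0 ?f0.
- move=> f sf [cf df Df].
  have H v z : A z -> is_derive z v (fun z => expR (f z)) (expR (f z) * 'D_v f z).
    move=> Az; apply: is_derive_comp_real.
    by apply/derivableP; exact: df.
  split=> [z Az|v z Az|v].
  + by apply: continuous_comp; [exact: cf|exact: continuous_expR].
  + by have [] := H v z Az.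
  + apply: smooth_closure_eq (smooth_closure_mul _ _ _
      (smooth_closure_exp _ _ sf) (Df v)) => z Az.
    by have [_ ->] := H v z Az.
- move=> f g fg sf [cf df Df].
  have N z : A z -> \near z, f z = g z.
    by move=> Az; move: (open_nbhs_nbhs (conj oA Az)); apply: filterS => w /fg.
  split=> [z Az|v z Az|v].
  + suff : g @ z --> g z by [].
    rewrite -(fg _ Az).
    exact: cvg_trans (near_eq_cvg (N z Az)) (cf z Az).
  + by apply: (near_eq_derivable (N z Az)); exact: df.
  + by apply: smooth_closure_eq (Df v) => z Az; apply: derive_on oA Az fg.
Qed.

Lemma smooth_closureP A f : open A -> smooth_closure A f <-> smooth_on A f.
Proof.
move=> oA; split; last exact: smooth_closure_base.
(* [foldr] applies the last direction of [s] first, so the induction peels off the right end and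
   continues with ['D_v f]. *)
move=> + s; elim/last_ind: s f => [|s v IH] f sf z Az.
  have [cf df _] := smooth_closure_step A f oA sf.
  by split=> [|v]; [exact: cf|exact: df].
rewrite foldr_rcons; apply: IH Az.
by have [] := smooth_closure_step A f oA sf.
Qed.

End Directional.

(* Otherwise a failed comparison of two derivatives unfolds their limits. *)
#[local] Opaque derive.

(** * Linear substitution, powers, and linear algebra in dimension two *)

Lemma is_derive_comp_linear {R : realType} {V : normedModType R} (f : V -> R)
    (L : V -> V) x v (df : R) :
  (forall h : R, L (h *: v + x) = h *: L v + L x) ->
  is_derive (L x) (L v) f df -> is_derive x v (f \o L) df.
Proof.
move=> Llin /is_derive_line0 H; apply/is_derive_line0.
by have -> : (fun h : R => (f \o L) (h *: v + x)) =
  (fun h : R => f (h *: L v + L x)) by apply/funext => h /=; rewrite Llin.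
Qed.

Lemma is_derive_exprz1 {R : realType} (m : int) :
  is_derive (1 : R) 1 (fun t : R => t ^ m) m%:~R.
Proof.
have H n : is_derive (1 : R) 1 (fun t : R => t ^+ n) n%:R.
  have := @is_deriveX R R (@id R) n 1 1 1 (is_derive_id _ _).
  rewrite [_ *: _]mulr1 /= expr1n mulr1.
  by have -> : (fun t : R => t ^+ n) = id ^+ n by apply/funext => t; rewrite exprfctE.
case: m => n; first exact: H.
have := is_derive_invf (fun t : R => t ^+ n.+1) 1 1 n.+1%:R.
rewrite /= !expr1n invr1 mulN1r oner_neq0 => /(_ isT (H _)).
by rewrite NegzE mulrNz.
Qed.

Lemma ord2P (P : 'I_2 -> Prop) : P 0 -> P 1 -> forall i, P i.
Proof.
move=> P0 P1 [[|[|//]] i2]; [move: P0|move: P1];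
  by congr (P _); apply/val_inj.
Qed.

Lemma sum_ord2 (R : nmodType) (f : 'I_2 -> R) : \sum_i f i = f 0 + f 1.
Proof.
rewrite big_ord_recl big_ord1; congr (f _ + f _); exact/val_inj.
Qed.

Lemma det_mx2 (R : comNzRingType) (A : 'M[R]_2) :
  \det A = A 0 0 * A 1 1 - A 0 1 * A 1 0.
Proof.
rewrite (expand_det_row _ 0) sum_ord2 /cofactor !det_mx11 !mxE /=.
rewrite expr0 expr1 mul1r mulN1r mulrN.
by congr (_ * A _ _ - _ * A _ _); apply/val_inj.
Qed.

(** In ['I_2] the index [1 - i] is the one different from [i], so the bracket is an entry of the
    adjugate. *)
Lemma invmx2E (R : fieldType) (A : 'M[R]_2) i j : \det A != 0 ->
  invmx A i j = (\det A)^-1 * (if i == j then A (1 - i) (1 - i) else - A i j).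
Proof.
move=> dA0.
pose B := \matrix_(i, j)
  ((\det A)^-1 * (if i == j then A (1 - i) (1 - i) else - A i j)).
have AB : A *m B = 1%:M.
  apply/matrixP => k l; rewrite !mxE sum_ord2 !mxE.
  by move: k l; apply: ord2P; apply: ord2P; rewrite /= ?subr0 ?subrr;
    move: dA0; rewrite det_mx2 => dA0; field.
have uA : A \in unitmx by rewrite unitmxE unitfE.
by rewrite -[invmx A]mulmx1 -AB mulKmx // mxE.
Qed.

(** Comparing [E0] with [T0] gives [y1 * (h01 - h10) = 0], comparing [E1] with [T1] gives
    [y0 * (h01 - h10) = 0], and one of [y0], [y1] is nonzero. *)
Lemma sym_of_kernel (R : idomainType) (y0 y1 h00 h01 h10 h11 c0 c1 : R) :
  ~~ ((y0 == 0) && (y1 == 0)) ->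
  y0 * h00 + y1 * h10 = c0 -> y0 * h01 + y1 * h11 = c1 ->
  y0 * h00 + y1 * h01 = c0 -> y0 * h10 + y1 * h11 = c1 -> h01 = h10.
Proof.
move=> y E0 E1 T0 T1; apply/eqP; rewrite -subr_eq0.
have P0 : y0 * (h01 - h10) = 0 by rewrite mulrBr; apply/eqP;
  rewrite subr_eq0 -(inj_eq (addIr (y1 * h11))) E1 T1.
have P1 : y1 * (h01 - h10) = 0 by rewrite mulrBr; apply/eqP;
  rewrite subr_eq0 -(inj_eq (addrI (y0 * h00))) E0 T0.
move/eqP: P0; rewrite mulf_eq0 => /orP[/eqP y00|//].
by move/eqP: P1; rewrite mulf_eq0 => /orP[/eqP y10|//]; rewrite y00 y10 eqxx in y.
Qed.

(** * Positively homogeneous functions on the fibers and Euler's theorem *)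

Section FiberHomogeneous.
Variable R : realType.
Local Notation TR2 := ('rV[R]_2 * 'rV[R]_2)%type.
Implicit Types (f g : TR2 -> R) (z : TR2) (i j k : 'I_2) (m n : int).
Variable A : set TR2.
Hypothesis oA : open A.
Hypothesis coneA : forall z (t : R), A z -> 0 < t -> A (z.1, t *: z.2).

Local Notation smooth := (smooth_closure A).

Definition fiber_homogeneous m f := forall z (t : R), A z -> 0 < t ->
  f (z.1, t *: z.2) = t ^ m * f z.
Local Notation hom := fiber_homogeneous.

Lemma smooth_derivable f z v : smooth f -> A z -> derivable f z v.
Proof. by move=> /(smooth_closure_step _ _ oA)[_ + _] => /[apply]. Qed.

Lemma smooth_dy i f : smooth f -> smooth (dy i f).
Proof. by move=> /(smooth_closure_step _ _ oA)[_ _]; exact. Qed.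

Lemma smooth_dx i f : smooth f -> smooth (dx i f).
Proof. by move=> /(smooth_closure_step _ _ oA)[_ _]; exact. Qed.

Lemma is_derive_dy i f z : smooth f -> A z ->
  is_derive z ((0, delta_mx 0 i) : TR2) f (dy i f z).
Proof. by move=> sf Az; apply/derivableP; exact: smooth_derivable. Qed.

Lemma is_derive_yc (z v : TR2) i : is_derive z v (yc i) (v.2 0 i).
Proof.
apply/is_derive_line0.
have -> : (fun h : R => yc i (h *: v + z)) = (v.2 0 i \*: id) + cst (z.2 0 i).
  by apply/funext => h /=; rewrite /yc /= !mxE mulrC.
rewrite -[X in is_derive _ _ _ X]addr0; apply: is_deriveD.
rewrite -[X in is_derive _ _ _ X]mulr1; exact: is_deriveZ.
Qed.

Lemma smooth_yc i : smooth (yc i).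
Proof.
apply: smooth_closure_base => s.
have D v : 'D_v (yc i) = cst (v.2 0 i) :> (TR2 -> R).
  by apply/funext => w; have [_] := is_derive_yc w v i.
have C (c : R) : smooth_on A (cst c : TR2 -> R).
  by apply/smooth_closureP => //; exact: smooth_closure_cst.
elim/last_ind: s => [z Az|s v _ z Az]; last first.
  by have := C (v.2 0 i) s z Az; rewrite -D -foldr_rcons.
split=> [|v]; last by have [] := is_derive_yc z v i.
apply: (@continuous_comp _ _ _ snd (fun M : 'rV[R]_2 => M 0 i)).
  exact: cvg_snd.
exact: coord_continuous.
Qed.

Lemma hom_eq m f g : (forall z, A z -> f z = g z) -> hom m f -> hom m g.
Proof. by move=> fg hf z t Az t0; rewrite -!fg ?hf //; exact: coneA. Qed.

Lemma hom_mul m n f g : hom m f -> hom n g -> hom (m + n) (fun z => f z * g z).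
Proof.
move=> hf hg z t Az t0; rewrite hf // hg // expfzDr ?gt_eqF //; ring.
Qed.

Lemma hom_add m f g : hom m f -> hom m g -> hom m (fun z => f z + g z).
Proof. by move=> hf hg z t Az t0; rewrite hf // hg // mulrDr. Qed.

Lemma hom_cst c : hom 0 (fun=> c).
Proof. by move=> z t _ _; rewrite expr0z mul1r. Qed.

Lemma hom_inv m f : hom m f -> hom (- m) (fun z => (f z)^-1).
Proof. by move=> hf z t Az t0; rewrite hf // invfM invr_expz. Qed.

Lemma hom_exp f : hom 0 f -> hom 0 (fun z => expR (f z)).
Proof. by move=> hf z t Az t0; rewrite hf // expr0z !mul1r. Qed.

Lemma hom_yc i : hom 1 (yc i).
Proof. by move=> z t _ _; rewrite /yc /= mxE expr1z. Qed.

(** On [A], [f] equals [t ^ m] times [f \o S], where the linear map [S] divides the fiber coordinate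
    by [t]. Directions in x are fixed by [S] and directions in y are divided by [t]; hence [dx]
    keeps the degree and [dy] lowers it by one. *)
Lemma is_derive_rescale m f z (v : TR2) (t df : R) :
  hom m f -> A z -> 0 < t ->
  is_derive z ((v.1, t^-1 *: v.2) : TR2) f df ->
  is_derive ((z.1, t *: z.2) : TR2) v f (t ^ m * df).
Proof.
move=> hf Az t0 H.
pose S (w : TR2) : TR2 := (w.1, t^-1 *: w.2).
apply: (is_derive_on A (fun w => t ^ m * f (S w))) => //; first exact: coneA.
  move=> w Aw; rewrite -hf; [|by apply: coneA; rewrite ?invr_gt0|by []].
  by rewrite /S /= scalerA mulfV ?gt_eqF // scale1r -surjective_pairing.
have := is_deriveZ; apply.
apply: is_derive_comp_linear.
  move=> h; rewrite /S; congr (_, _) => /=.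
  by rewrite scalerDr !scalerA mulrC.
suff -> : S (z.1, t *: z.2) = z by [].
by rewrite /S /= scalerA mulVf ?gt_eqF // scale1r -surjective_pairing.
Qed.

Lemma hom_dy m f i : smooth f -> hom m f -> hom (m - 1) (dy i f).
Proof.
move=> sf hf z t Az t0.
have /(is_derive_scale_dir _ _ _ t^-1) := is_derive_dy i f z sf Az.
move=> H; have [] := @is_derive_rescale m f z (0, delta_mx 0 i) t
  (dy i f z * t^-1) hf Az t0 _.
  by move: H; congr is_derive; congr (_, _); rewrite scaler0.
move=> _ E; rewrite /dy E -/(dy i f z) expfzDr ?gt_eqF // exprN1; ring.
Qed.

Lemma hom_dx m f i : smooth f -> hom m f -> hom m (dx i f).
Proof.
move=> sf hf z t Az t0.
have H : is_derive z ((delta_mx 0 i, t^-1 *: 0) : TR2) f (dx i f z).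
  by rewrite scaler0; apply/derivableP; exact: smooth_derivable.
have [_ E] := is_derive_rescale m f z (delta_mx 0 i, 0) t _ hf Az t0 H.
by rewrite /dx E.
Qed.

Lemma dy_val f i z (d : R) :
  is_derive z ((0, delta_mx 0 i) : TR2) f d -> dy i f z = d.
Proof. by case. Qed.

Lemma dy_congr f g i z : A z -> (forall w, A w -> f w = g w) ->
  dy i f z = dy i g z.
Proof. by move=> Az fg; apply: (derive_on A). Qed.

Lemma dyD f g i z : smooth f -> smooth g -> A z ->
  dy i (fun w => f w + g w) z = dy i f z + dy i g z.
Proof.
move=> sf sg Az.
by have [] := is_derive_addf _ _ _ _ _ _ (is_derive_dy i f z sf Az)
  (is_derive_dy i g z sg Az).
Qed.

Lemma dyM f g i z : smooth f -> smooth g -> A z ->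
  dy i (fun w => f w * g w) z = f z * dy i g z + dy i f z * g z.
Proof.
move=> sf sg Az.
by have [] := is_derive_mulf _ _ _ _ _ _ (is_derive_dy i f z sf Az)
  (is_derive_dy i g z sg Az).
Qed.

Lemma dyZ c f i z : smooth f -> A z -> dy i (fun w => c * f w) z = c * dy i f z.
Proof.
move=> sf Az; rewrite (dyM _ _ i z (smooth_closure_cst A c) sf Az).
by rewrite /dy derive_cst mul0r addr0.
Qed.

Lemma dy_exp f i z : smooth f -> A z ->
  dy i (fun w => expR (f w)) z = expR (f z) * dy i f z.
Proof.
move=> sf Az.
by have [] := is_derive_comp_real f expR _ _ _ _ (is_derive_dy i f z sf Az)
  (is_derive_expR _).
Qed.

(** The derivative in the radial direction [(0, z.2)] is computed twice: by additivity in the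
    direction ([D1]), and from homogeneity along the ray ([D2]). *)
Lemma euler m f z : smooth f -> hom m f -> A z ->
  yc 0 z * dy 0 f z + yc 1 z * dy 1 f z = m%:~R * f z.
Proof.
move=> sf hf Az.
pose e (i : 'I_2) : TR2 := (0, delta_mx 0 i).
have D1 : is_derive z (yc 0 z *: e 0 + yc 1 z *: e 1) f
    (yc 0 z * dy 0 f z + yc 1 z * dy 1 f z).
  have De i : is_derive z (yc i z *: e i) f (yc i z * dy i f z).
    by rewrite mulrC; apply: is_derive_scale_dir; exact: is_derive_dy.
  have [_ <-] := De 0; have [_ <-] := De 1.
  apply: (is_derive_add_dir A) => //.
  - by move=> w Aw; exact: smooth_derivable.
  - have [_ _ /(_ (yc 1 z *: e 1)) sD] := smooth_closure_step _ _ oA sf.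
    by have [cD _ _] := smooth_closure_step _ _ oA sD; exact: cD.
(* Along the ray [f] is [(h + 1) ^ m * f z] as long as [h + 1] is positive, which holds near
   [h = 0]. *)
have D2 : is_derive z ((0, z.2) : TR2) f (m%:~R * f z).
  apply/is_derive_line0.
  apply: (@near_eq_is_derive _ _ _ (fun h : R => (h + 1) ^ m * f z)).
    have : \forall h \near (0 : R), -1 < h by apply: lt_nbhsr; rewrite oppr_lt0.
    apply: filterS => h h1; rewrite -hf //; last by lra.
    congr f; case: (z) => x y; congr (_, _) => /=.
      by rewrite scaler0 add0r.
    by rewrite scalerDl scale1r.
  have -> : (fun h : R => (h + 1) ^ m * f z) =
      (f z) \*: (fun h : R => (h *: 1 + 1) ^ m).
    by apply/funext => h /=; rewrite [h *: 1]mulr1 mulrC.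
  rewrite mulrC; apply: is_deriveZ.
  apply/(is_derive_line0 (fun t : R => t ^ m) 1 1); exact: is_derive_exprz1.
have E : yc 0 z *: e 0 + yc 1 z *: e 1 = (0, z.2) :> TR2.
  congr (_, _); first by rewrite /e /= !scaler0 addr0.
  apply/rowP => i; rewrite !mxE.
  by move: i; apply: ord2P; rewrite /= /yc ?mulr1 ?mulr0 ?addr0 ?add0r.
rewrite E in D1; have [_ <-] := D1; by have [_ <-] := D2.
Qed.

Lemma euler_hessian m f i z : smooth f -> hom m f -> A z ->
  yc 0 z * dy 0 (dy i f) z + yc 1 z * dy 1 (dy i f) z = (m - 1)%:~R * dy i f z.
Proof.
move=> sf hf Az; apply: euler => //; [exact: smooth_dy|exact: hom_dy].
Qed.

(** Obtained by differentiating Euler's relation for [f], whereas [euler_hessian] applies Euler's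
    theorem to a derivative of [f]. The mixed derivatives therefore appear in the opposite order. *)
Lemma euler_hessian_tr m f j z : smooth f -> hom m f -> A z ->
  yc 0 z * dy j (dy 0 f) z + yc 1 z * dy j (dy 1 f) z = (m - 1)%:~R * dy j f z.
Proof.
move=> sf hf Az.
pose v : TR2 := (0, delta_mx 0 j).
have P i : is_derive z v (fun w => yc i w * dy i f w)
    (yc i z * dy j (dy i f) z + v.2 0 i * dy i f z).
  apply: is_derive_mulf; first exact: is_derive_yc.
  by apply: is_derive_dy => //; exact: smooth_dy.
have [_ D1] := is_derive_addf _ _ _ _ _ _ (P 0) (P 1).
have [_ D2] := is_derive_mulf _ _ _ _ _ _
  (is_derive_cst (m%:~R : R) z v) (is_derive_dy j f z sf Az).
have E : 'D_v (fun w => yc 0 w * dy 0 f w + yc 1 w * dy 1 f w) z =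
         'D_v (fun w => m%:~R * f w) z.
  by apply: (derive_on A) => // w Aw; exact: euler.
rewrite D1 D2 mul0r addr0 /cst in E.
have {}E : yc 0 z * dy j (dy 0 f) z + yc 1 z * dy j (dy 1 f) z + dy j f z =
           m%:~R * dy j f z.
  rewrite -E addrACA; congr (_ + _); rewrite /v /=.
  by move: (j); apply: ord2P; rewrite !mxE /= ?mul1r ?mul0r ?addr0 ?add0r.
by rewrite intrB mulrBl mul1r -E addrK.
Qed.

Hypothesis A_neq0 : forall z, A z -> z.2 != 0.

Lemma yc_neq0 z : A z -> ~~ ((yc 0 z == 0) && (yc 1 z == 0)).
Proof.
move=> /A_neq0; apply: contra => /andP[/eqP y0 /eqP y1].
by apply/eqP/rowP; apply: ord2P; rewrite mxE.
Qed.

(* Both Euler relations for the Hessian make it symmetric on y; in dimension 2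
   an antisymmetric matrix killing [y != 0] vanishes, so that no Schwarz
   theorem is needed. *)
Lemma hessian_sym m f i j z : smooth f -> hom m f -> A z ->
  dy i (dy j f) z = dy j (dy i f) z.
Proof.
move=> sf hf Az; suff S : dy 0 (dy 1 f) z = dy 1 (dy 0 f) z.
  move: i j; apply: ord2P; apply: ord2P;
    [exact: erefl|exact: S|exact: esym S|exact: erefl].
exact: (sym_of_kernel _ _ _ _ _ _ _ _ _ (yc_neq0 z Az)
  (euler_hessian m f 0 z sf hf Az) (euler_hessian m f 1 z sf hf Az)
  (euler_hessian_tr m f 0 z sf hf Az) (euler_hessian_tr m f 1 z sf hf Az)).
Qed.

End FiberHomogeneous.

(* The algebraic identity behind the determinant of the changed metric *)
#[local] Opaque dy dx.

(** Values at one point: [Fi], [Fij], [pi], [pij] are y-derivatives of F and phi, [s] is the square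
    root of the absolute value of det g, [di] and [si] are the derivatives of det g and [s], [P] is
    phi_;2 and [d2P] is phi_;2;2. The [hij] are the entries of the changed metric without the factor
    e^(2 phi). *)
Lemma conformal_det_identity (K : fieldType)
    (F y0 y1 F0 F1 s eps I l u F00 F01 F11 p0 p1 p00 p01 p11
     d0 d1 s0 s1 P P0 P1 d2P : K) :
  F = y0 * F0 + y1 * F1 -> F != 0 -> s != 0 -> (2 : K) != 0 ->
  let k := eps * s ^+ 2 / F ^+ 3 in
  F00 = k * (y1 * y1) -> F01 = - k * (y0 * y1) -> F11 = k * (y0 * y0) ->
  p0 = - l * y1 -> p1 = l * y0 ->
  p00 = u * (y1 * y1) + l / F * (y1 * F0 + F0 * y1) ->
  p01 = - u * (y0 * y1) + l / F * (y1 * F1 - F0 * y0) ->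
  p11 = u * (y0 * y0) - l / F * (y0 * F1 + F1 * y0) ->
  let g00 := F0 * F0 + F * F00 in
  let g01 := F0 * F1 + F * F01 in
  let g11 := F1 * F1 + F * F11 in
  let c := 2 * I * s ^+ 3 / F ^+ 4 in
  d0 = - c * y1 * (y1 ^+ 2 * g11 + y0 ^+ 2 * g00 + 2 * (y0 * y1) * g01) ->
  d1 = c * y0 * (y1 ^+ 2 * g11 + y0 ^+ 2 * g00 + 2 * (y0 * y1) * g01) ->
  s0 = eps * d0 / (2 * s) -> s1 = eps * d1 / (2 * s) ->
  let Q := F0 * p1 - F1 * p0 in
  P = F / s * Q ->
  P0 = (F0 / s - F * s0 / s ^+ 2) * Q
       + F / s * (F00 * p1 + F0 * p01 - (F01 * p0 + F1 * p00)) ->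
  P1 = (F1 / s - F * s1 / s ^+ 2) * Q
       + F / s * (F01 * p1 + F0 * p11 - (F11 * p0 + F1 * p01)) ->
  d2P = F / s * (F0 * P1 - F1 * P0) ->
  let h00 := g00 + 2 * F * (p0 * F0 + p0 * F0) + (2 * (p0 * p0) + p00) * F ^+ 2 in
  let h01 := g01 + 2 * F * (p0 * F1 + p1 * F0) + (2 * (p0 * p1) + p01) * F ^+ 2 in
  let h11 := g11 + 2 * F * (p1 * F1 + p1 * F1) + (2 * (p1 * p1) + p11) * F ^+ 2 in
  h00 * h11 - h01 * h01 =
    s ^+ 2 * (d2P + eps * I * P + 2 * P ^+ 2 + eps - P ^+ 2).
Proof.
move=> EF F0' s0' two0 k -> -> -> -> -> -> -> -> g00 g01 g11 c.
(* This is g_ij y^i y^j = F^2: the Hessian part of g is killed by y. *)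
have -> : y1 ^+ 2 * g11 + y0 ^+ 2 * g00 + 2 * (y0 * y1) * g01 = F ^+ 2.
  by rewrite [in RHS]EF /g11 /g00 /g01; ring.
move=> -> -> -> -> Q.
have kF : F ^+ 3 * k = eps * s ^+ 2 by rewrite /k; field.
have QE : Q = l * F by rewrite [in RHS]EF /Q; ring.
rewrite QE => -> -> -> ->.
(* Writing [l] as a multiple of [F] removes the quotient [l / F], so that polynomial identities
   remain. *)
have [a la] : exists a, l = a * F by exists (l / F); rewrite divfK.
have laF : l / F = a by rewrite la mulfK.
rewrite !laF.
(* This rewrite and the next evaluate the two y-derivatives of [Q]. *)
have -> : k * (y1 * y1) * (l * y0) +
    F0 * (- u * (y0 * y1) + a * (y1 * F1 - F0 * y0)) -
    (- k * (y0 * y1) * (- l * y1) +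
     F1 * (u * (y1 * y1) + a * (y1 * F0 + F0 * y1))) = - u * y1 * F - l * F0.
  by rewrite la EF; ring.
have -> : - k * (y0 * y1) * (l * y0) +
    F0 * (u * (y0 * y0) - a * (y0 * F1 + F1 * y0)) -
    (k * (y0 * y0) * (- l * y1) +
     F1 * (- u * (y0 * y1) + a * (y1 * F1 - F0 * y0))) = u * y0 * F - l * F1.
  by rewrite la EF; ring.
(* [L] is [F0 * P1 - F1 * P0]. The main scalar enters it through the derivatives of [s], and this
   term cancels [eps * I * P] in the goal. *)
set L := F0 * _ - F1 * _.
have -> : L = F ^+ 3 * u / s - eps * I * l * F.
  transitivity (F ^+ 2 * u * (y0 * F0 + y1 * F1) / s -
      eps * I * l * (y0 * F0 + y1 * F1)); last by rewrite -EF; field.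
  by rewrite /L /c; field; apply/and3P.
(* Common value of both sides: the right one reaches it through [kF], the left one with [k] as an
   indeterminate. *)
move=> h00 h01 h11; transitivity (F ^+ 4 * (u + l ^+ 2) + F ^+ 3 * k); last first.
  by rewrite kF; field.
by rewrite /h00 /h01 /h11 la /g00 /g01 /g11 EF; clearbody k; ring.
Qed.

(** * Smoothness and degree of metric and spray; the metric of a conformal change *)

Section FinslerDomain.
Variable R : realType.
Local Notation TR2 := ('rV[R]_2 * 'rV[R]_2)%type.
Implicit Types (f g : TR2 -> R) (z : TR2) (i j k : 'I_2) (m n : int).
Variable A : set TR2.
Hypothesis oA : open A.
Hypothesis coneA : forall z (t : R), A z -> 0 < t -> A (z.1, t *: z.2).

Local Notation smooth := (smooth_closure A).
Local Notation hom := (fiber_homogeneous R A).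

(** Both properties travel together because every use of Euler's theorem asks for both. *)
Definition smooth_hom m f := smooth f /\ hom m f.
Local Notation sh := smooth_hom.

Lemma sh_eq m f g : (forall z, A z -> f z = g z) -> sh m f -> sh m g.
Proof.
move=> fg [sf hf]; split; first exact: smooth_closure_eq fg sf.
exact: hom_eq coneA _ _ _ fg hf.
Qed.

Lemma sh_add m f g : sh m f -> sh m g -> sh m (fun z => f z + g z).
Proof.
by move=> [sf hf] [sg hg]; split; [exact: smooth_closure_add|exact: hom_add].
Qed.

Lemma sh_mul m n f g : sh m f -> sh n g -> sh (m + n) (fun z => f z * g z).
Proof.
by move=> [sf hf] [sg hg]; split; [exact: smooth_closure_mul|exact: hom_mul].
Qed.

Lemma sh_cst c : sh 0 (fun=> c).
Proof. by split; [exact: smooth_closure_cst|exact: hom_cst]. Qed.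

Lemma sh_opp m f : sh m f -> sh m (fun z => - f z).
Proof.
move=> sf; have := sh_mul 0 m _ _ (sh_cst (-1)) sf; rewrite add0r.
by apply: sh_eq => z _; rewrite mulN1r.
Qed.

Lemma sh_inv m f : sh m f -> (forall z, A z -> f z != 0) ->
  sh (- m) (fun z => (f z)^-1).
Proof.
by move=> [sf hf] f0; split; [exact: smooth_closure_inv|exact: hom_inv].
Qed.

Lemma sh_exp f : sh 0 f -> sh 0 (fun z => expR (f z)).
Proof.
by move=> [sf hf]; split; [exact: smooth_closure_exp|exact: hom_exp].
Qed.

Lemma sh_yc i : sh 1 (yc i).
Proof. by split; [exact: smooth_yc|exact: hom_yc]. Qed.

Lemma sh_dy m f i : sh m f -> sh (m - 1) (dy i f).
Proof. by move=> [sf hf]; split; [exact: smooth_dy|exact: hom_dy]. Qed.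

Lemma sh_dx m f i : sh m f -> sh m (dx i f).
Proof. by move=> [sf hf]; split; [exact: smooth_dx|exact: hom_dx]. Qed.

Lemma sh_sq f : sh 1 f -> sh 2 (sq f).
Proof. by move=> sf; apply: sh_eq (sh_mul 1 1 _ _ sf sf) => z _. Qed.

Lemma sh_metric f i j : sh 1 f -> sh 0 (fun z => metric f z i j).
Proof.
move=> /sh_sq /(sh_dy 2 _ j) /(sh_dy (2 - 1) _ i) /(sh_mul 0 0 _ _ (sh_cst 2^-1)).
by apply: sh_eq => z _; rewrite mxE.
Qed.

Lemma sh_det_metric f : sh 1 f -> sh 0 (fun z => \det (metric f z)).
Proof.
move=> sf; have G i j := sh_metric f i j sf.
have := sh_add 0 _ _ (sh_mul 0 0 _ _ (G 0 0) (G 1 1))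
  (sh_opp 0 _ (sh_mul 0 0 _ _ (G 0 1) (G 1 0))).
by apply: sh_eq => z _; rewrite det_mx2.
Qed.

Lemma sh_metric_inv f i j : sh 1 f ->
  (forall z, A z -> \det (metric f z) != 0) ->
  sh 0 (fun z => metric_inv f z i j).
Proof.
move=> sf d0; have Di := sh_inv 0 _ (sh_det_metric f sf) d0.
have G k l := sh_metric f k l sf.
have B : sh 0 (fun z => if i == j then metric f z (1 - i) (1 - i)
                        else - metric f z i j).
  by case: (i == j); [exact: G|apply: sh_opp].
apply: sh_eq (sh_mul 0 0 _ _ Di B) => z Az.
by rewrite /metric_inv invmx2E // d0.
Qed.

(** The inverse metric has degree 0; the x-derivatives of F^2 have degree 2, and so has y^k times
    their y-derivatives. *)
Lemma sh_spray f i : sh 1 f -> (forall z, A z -> \det (metric f z) != 0) ->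
  sh 2 (spray f i).
Proof.
move=> sf d0.
have sE := sh_sq f sf.
have T k j : sh 2 (fun z => yc k z * dy j (dx k (sq f)) z).
  exact: (sh_mul 1 1 _ _ (sh_yc k) (sh_dy 2 _ j (sh_dx 2 _ k sE))).
have B j : sh 2 (fun z => metric_inv f z i j *
    ((yc 0 z * dy j (dx 0 (sq f)) z + yc 1 z * dy j (dx 1 (sq f)) z)
      - dx j (sq f) z)).
  apply: (sh_mul 0 2); first exact: sh_metric_inv.
  by apply: sh_add; [apply: sh_add; exact: T|apply: sh_opp; exact: sh_dx].
have := sh_mul 0 2 _ _ (sh_cst 4^-1) (sh_add 2 _ _ (B 0) (B 1)).
apply: sh_eq => z _; rewrite /spray.
by under eq_bigr => j _ do rewrite sum_ord2; rewrite sum_ord2.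
Qed.

(** Euler's theorem writes [m] times each function through its y-derivatives, and [m] can be
    cancelled. *)
Lemma sh_dy_inj m f g : sh m f -> sh m g -> m != 0 ->
  (forall z, A z -> forall i, dy i f z = dy i g z) ->
  forall z, A z -> f z = g z.
Proof.
move=> [sf hf] [sg hg] m0 E z Az.
have m0' : m%:~R != 0 :> R by rewrite intr_eq0.
apply: (mulfI m0').
by rewrite -(euler _ _ oA m f) // -(euler _ _ oA m g) // !E.
Qed.

Lemma metricE f i j z : smooth f -> A z ->
  metric f z i j = dy i f z * dy j f z + f z * dy i (dy j f) z.
Proof.
move=> sf Az; have sdf := smooth_dy _ _ oA j f sf.
rewrite mxE (dy_congr _ _ oA _ (fun w => 2 * (f w * dy j f w)) i z Az); last first.
  move=> w Aw; rewrite (dy_congr _ _ oA _ (fun w => f w * f w) j w Aw); last by [].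
  rewrite (dyM _ _ oA f f j w sf sf Aw).
  by generalize (dy j f w) => a; ring.
rewrite (dyZ _ _ oA _ _ i z (smooth_closure_mul _ _ _ sf sdf) Az).
rewrite (dyM _ _ oA f (dy j f) i z sf sdf Az).
by generalize (dy i f z) (dy j f z) (dy i (dy j f) z) (f z) => a b c d; field.
Qed.

Lemma metric_conformal F phi i j z : smooth F -> smooth phi -> A z ->
  metric (fun w => expR (phi w) * F w) z i j = expR (phi z) ^+ 2 *
    (dy i F z * dy j F z + F z * dy i (dy j F) z
     + 2 * F z * (dy i phi z * dy j F z + dy j phi z * dy i F z)
     + (2 * (dy i phi z * dy j phi z) + dy i (dy j phi) z) * F z ^+ 2).
Proof.
move=> sF sp Az.
have sdF k := smooth_dy _ _ oA k F sF.
have sdp k := smooth_dy _ _ oA k phi sp.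
have se := smooth_closure_exp A phi sp.
have sq j' : smooth (fun w => dy j' phi w * F w).
  exact: smooth_closure_mul.
have D k w : A w -> dy k (fun w => expR (phi w) * F w) w =
    expR (phi w) * (dy k phi w * F w + dy k F w).
  move=> Aw; rewrite (dyM _ _ oA _ _ k w se sF Aw) (dy_exp _ _ oA phi k w sp Aw).
  by generalize (dy k F w) (dy k phi w) => a b; ring.
have DD : dy i (fun w => expR (phi w) * (dy j phi w * F w + dy j F w)) z =
    expR (phi z) * (dy i phi z * (dy j phi z * F z + dy j F z) +
      (dy i (dy j phi) z * F z + dy j phi z * dy i F z + dy i (dy j F) z)).
  rewrite (dyM _ _ oA _ _ i z se (smooth_closure_add _ _ _ (sq j) (sdF j)) Az).
  rewrite (dyD _ _ oA _ _ i z (sq j) (sdF j) Az) (dyM _ _ oA _ _ i z (sdp j) sF Az).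
  rewrite (dy_exp _ _ oA phi i z sp Az).
  generalize (dy i F z) (dy i phi z) (dy j F z) (dy j phi z)
    (dy i (dy j phi) z) (dy i (dy j F) z) => a b c d e f; ring.
rewrite (metricE _ i j z (smooth_closure_mul _ _ _ se sF) Az).
rewrite (dy_congr _ _ oA _ _ i z Az (D j)) (D i z Az) (D j z Az) DD.
by generalize (dy i F z) (dy i phi z) (dy j F z) (dy j phi z)
    (dy i (dy j phi) z) (dy i (dy j F) z) => a b c d e f; ring.
Qed.

End FinslerDomain.

(** * Symmetric tensors annihilated by y in dimension two *)

Section Perp.
Variables (K : fieldType) (y0 y1 : K).
Hypothesis y_neq0 : ~~ ((y0 == 0) && (y1 == 0)).

(** A generator of the line of covectors that vanish on y. *)
Definition perp (k : 'I_2) : K := if k == 0 then - y1 else y0.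

Lemma kernel_line : exists w : 'I_2 -> K, forall u : 'I_2 -> K,
  y0 * u 0 + y1 * u 1 = 0 ->
  forall k, u k = (w 0 * u 0 + w 1 * u 1) * perp k.
Proof.
have [y00|y0n] := eqVneq y0 0.
  have y1n : y1 != 0 by move: y_neq0; rewrite y00 eqxx.
  exists (fun k => if k == 0 then - y1^-1 else 0) => u; rewrite y00 mul0r add0r.
  move=> /eqP; rewrite mulf_eq0 (negPf y1n) => /eqP u1.
  by apply: ord2P; rewrite /perp /= ?u1 ?y00; field.
exists (fun k => if k == 0 then 0 else y0^-1) => u uy.
apply: ord2P; rewrite /perp /=; last by field.
by apply: (mulfI y0n); move: uy => /eqP; rewrite addr_eq0 => /eqP ->; field.
Qed.

(** [kernel_line] is applied in one slot, then to the remaining covector [h], which symmetry shows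
    to vanish on y as well. *)
Lemma sym_kernel_perp2 (H : 'I_2 -> 'I_2 -> K) :
  (forall i j, H i j = H j i) -> (forall j, y0 * H 0 j + y1 * H 1 j = 0) ->
  exists k, forall i j, H i j = k * perp i * perp j.
Proof.
move=> sH kH; have [w wP] := kernel_line.
pose h j := w 0 * H 0 j + w 1 * H 1 j.
have kh : y0 * h 0 + y1 * h 1 = 0.
  transitivity (w 0 * (y0 * H 0 0 + y1 * H 0 1) + w 1 * (y0 * H 1 0 + y1 * H 1 1)).
    by rewrite /h; ring.
  have kH' i : y0 * H i 0 + y1 * H i 1 = 0 by rewrite (sH i 0) (sH i 1).
  by rewrite !kH' !mulr0 addr0.
exists (w 0 * h 0 + w 1 * h 1) => i j.
by rewrite (wP (H^~ j) (kH j)) -/(h j) (wP h kh j); ring.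
Qed.

Lemma sym_kernel_perp3 (T : 'I_2 -> 'I_2 -> 'I_2 -> K) :
  (forall i j k, T i j k = T j i k) -> (forall i j k, T i j k = T k j i) ->
  (forall i j, y0 * T i j 0 + y1 * T i j 1 = 0) ->
  exists c, forall i j k, T i j k = c * perp i * perp j * perp k.
Proof.
move=> s12 s13 kT; have [w wP] := kernel_line.
pose S i j := w 0 * T i j 0 + w 1 * T i j 1.
have [i j|j|c cP] := @sym_kernel_perp2 S.
- by rewrite /S !(s12 i j).
- transitivity (w 0 * (y0 * T 0 j 0 + y1 * T 1 j 0)
    + w 1 * (y0 * T 0 j 1 + y1 * T 1 j 1)); first by rewrite /S; ring.
  have kT' k : y0 * T 0 j k + y1 * T 1 j k = 0.
    by rewrite (s13 0 j k) (s13 1 j k).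
  by rewrite !kT' !mulr0 addr0.
exists c => i j k.
by rewrite (wP (T i j) (kT i j)) -/(S i j) cP.
Qed.
End Perp.

Lemma metric_invE (R : realType) (F : 'rV[R]_2 * 'rV[R]_2 -> R) z :
  let g := metric F z in let d := \det g in d != 0 ->
  [/\ metric_inv F z 0 0 = d^-1 * g 1 1, metric_inv F z 0 1 = d^-1 * - g 0 1,
     metric_inv F z 1 0 = d^-1 * - g 1 0 & metric_inv F z 1 1 = d^-1 * g 0 0].
Proof.
move=> g d d0; rewrite /metric_inv !invmx2E // -/g -/d.
by split=> //; congr (_ * g _ _); exact/val_inj.
Qed.

(** * The modified Berwald frame and the derivative f_;2 in explicit form *)

Section FinslerFrame.
Variable R : realType.
Local Notation TR2 := ('rV[R]_2 * 'rV[R]_2)%type.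
Implicit Types (f g : TR2 -> R) (z : TR2) (i j k : 'I_2).
Variable A : set TR2.
Hypothesis oA : open A.
Hypothesis coneA : forall z (t : R), A z -> 0 < t -> A (z.1, t *: z.2).
Hypothesis A_neq0 : forall z, A z -> z.2 != 0.

Local Notation smooth := (smooth_closure A).
Local Notation hom := (fiber_homogeneous R A).
Local Notation sh := (smooth_hom R A).

Variable F : TR2 -> R.
Hypothesis shF : sh 1 F.
Hypothesis F_neq0 : forall z, A z -> F z != 0.
Hypothesis det_neq0 : forall z, A z -> \det (metric F z) != 0.

Local Notation eps := (signature F).
Local Notation n z := (perp _ (yc 0 z) (yc 1 z)).
Let s z := Num.sqrt (eps z * \det (metric F z)).

(** This form replaces the sign function by square roots of positive numbers, to which the chain
    rule applies. *)
Lemma s_abs z : s z = Num.sqrt (Num.sqrt (\det (metric F z) ^+ 2)).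
Proof. by rewrite sqrtr_sqr normrEsg. Qed.

Lemma s_gt0 z : A z -> 0 < s z.
Proof. by move=> Az; rewrite s_abs !sqrtr_gt0 exprn_even_gt0 //= det_neq0. Qed.

Lemma eps_sq z : A z -> eps z ^+ 2 = 1.
Proof. by move=> Az; rewrite sqr_sg det_neq0. Qed.

Lemma s_sq z : A z -> s z ^+ 2 = eps z * \det (metric F z).
Proof.
by move=> Az; rewrite sqr_sqrtr // -normrEsg.
Qed.

Lemma det_s z : A z -> \det (metric F z) = eps z * s z ^+ 2.
Proof. by move=> Az; rewrite s_sq // mulrA -expr2 eps_sq // mul1r. Qed.

Lemma m_loE i z : m_lo F i z = s z / F z * n z i.
Proof.
rewrite /m_lo /ell_up /perp -/(s z); case: (i == 0); last by ring.
by ring.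
Qed.

Lemma smF : smooth F. Proof. by case: shF. Qed.
Lemma hoF : hom 1 F. Proof. by case: shF. Qed.

Lemma eulerF z : A z -> F z = yc 0 z * dy 0 F z + yc 1 z * dy 1 F z.
Proof. by move=> Az; rewrite (euler _ _ oA 1 F z smF hoF Az) mul1r. Qed.

Lemma hessF_sym i j z : A z -> dy i (dy j F) z = dy j (dy i F) z.
Proof. exact: (hessian_sym _ _ oA coneA A_neq0 1 F i j z smF hoF). Qed.

Lemma hessF_y j z : A z ->
  yc 0 z * dy 0 (dy j F) z + yc 1 z * dy 1 (dy j F) z = 0.
Proof.
move=> Az; rewrite (euler_hessian _ _ oA coneA 1 F j z smF hoF Az).
by rewrite subrr mul0r.
Qed.

Lemma metricFE i j z : A z ->
  metric F z i j = dy i F z * dy j F z + F z * dy i (dy j F) z.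
Proof. exact: metricE smF. Qed.

Lemma metricF_sym i j z : A z -> metric F z i j = metric F z j i.
Proof.
move=> Az; rewrite (metricFE i j z Az) (metricFE j i z Az) (hessF_sym i j z Az).
by generalize (dy i F z) (dy j F z) (dy j (dy i F) z) => a b c; ring.
Qed.

Lemma metricF_y i z : A z ->
  metric F z i 0 * yc 0 z + metric F z i 1 * yc 1 z = F z * dy i F z.
Proof.
move=> Az; rewrite (metricF_sym i 0 z Az) (metricF_sym i 1 z Az).
rewrite (metricFE 0 i z Az) (metricFE 1 i z Az).
have alg (f y0 y1 a b c d e : R) : f = y0 * a + y1 * b -> y0 * d + y1 * e = 0 ->
    (a * c + f * d) * y0 + (b * c + f * e) * y1 = f * c.
  move=> E H; transitivity ((y0 * a + y1 * b) * c + f * (y0 * d + y1 * e)).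
    by ring.
  by rewrite H -E mulr0 addr0.
exact: alg (eulerF z Az) (hessF_y i z Az).
Qed.

(** The inverse metric is the adjugate over the determinant; the adjugate applied to n = (-y2, y1)
    is g y turned by a right angle, and g_ij y^j = F F_i. *)
Lemma m_upE i z : A z ->
  m_up F i z = s z / \det (metric F z) * (if i == 0 then - dy 1 F z else dy 0 F z).
Proof.
move=> Az; have d0 := det_neq0 z Az; have F0 := F_neq0 z Az.
rewrite /m_up sum_ord2 (m_loE 0) (m_loE 1); have [V00 V01 V10 V11] := metric_invE _ F z d0.
have E0 := metricF_y 0 z Az; have E1 := metricF_y 1 z Az.
have S := metricF_sym 0 1 z Az.
have {}E0 : dy 0 F z = (metric F z 0 0 * yc 0 z + metric F z 0 1 * yc 1 z) / F z.
  by rewrite E0 mulrC mulKf.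
have {}E1 : dy 1 F z = (metric F z 1 0 * yc 0 z + metric F z 1 1 * yc 1 z) / F z.
  by rewrite E1 mulrC mulKf.
rewrite E0 E1 -S; move: d0; rewrite /perp /=.
move: F0; move: i; apply: ord2P;
  rewrite /= ?V00 ?V01 ?V10 ?V11 -?S;
  generalize (\det (metric F z)) (s z) (F z) (yc 0 z) (yc 1 z)
    (metric F z 0 0) (metric F z 0 1) (metric F z 1 1)
    => d t f y0 y1 a b c f0 d0; by field; rewrite d0 f0.
Qed.

Lemma d2E f z : A z -> d2 F f z =
  F z / s z * (dy 0 F z * dy 1 f z - dy 1 F z * dy 0 f z).
Proof.
move=> Az; rewrite /d2 sum_ord2 (m_upE 0 z Az) (m_upE 1 z Az) /= (det_s z Az).
have s0 : s z != 0 by rewrite gt_eqF // s_gt0.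
have e0 : eps z != 0 by rewrite sgr_eq0 det_neq0.
generalize (dy 0 F z) (dy 1 F z) (dy 0 f z) (dy 1 f z) => a b c d.
by field; rewrite s0 e0.
Qed.

Lemma is_derive_s k z : A z ->
  is_derive z ((0, delta_mx 0 k) : TR2) s
    (eps z * dy k (fun w => \det (metric F w)) z / (2 * s z)).
Proof.
move=> Az; have d0 := det_neq0 z Az.
have [sD _] := sh_det_metric _ _ oA coneA F shF.
have D := is_derive_dy _ _ oA k _ z sD Az.
have D2 := is_derive_mulf _ _ _ _ _ _ D D.
have D3 := is_derive_comp_real _ Num.sqrt _ _ _ _ D2.
have p2 : 0 < \det (metric F z) * \det (metric F z).
  by rewrite -expr2 exprn_even_gt0.
have {}D3 := D3 _ (is_derive1_sqrt p2).
have D4 := is_derive_comp_real _ Num.sqrt _ _ _ _ D3.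
have p4 : 0 < Num.sqrt (\det (metric F z) * \det (metric F z)).
  by rewrite sqrtr_gt0.
have {}D4 := D4 _ (is_derive1_sqrt p4).
have E : s = fun w => Num.sqrt (Num.sqrt (\det (metric F w) * \det (metric F w))).
  by apply/funext => w; rewrite s_abs expr2.
rewrite {1}E; apply: is_derive_eq D4 _.
rewrite -expr2 -s_abs sqrtr_sqr normrEsg -/(eps z).
have s0 : s z != 0 by rewrite gt_eqF // s_gt0.
have e0 : eps z != 0 by rewrite sgr_eq0 det_neq0.
(* The chain rule leaves the sign in the denominator; [eps z ^+ 2 = 1] moves it to the numerator. *)
have -> : eps z * dy k (fun w => \det (metric F w)) z / (2 * s z) =
  dy k (fun w => \det (metric F w)) z / (eps z * (2 * s z)) * eps z ^+ 2.
  by field; rewrite s0 e0.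
rewrite eps_sq // mulr1.
by field; rewrite d0 s0 e0.
Qed.

(** * The Cartan tensor, the main scalar and the normal form of the Hessian of F *)

Lemma dy_metric_sym12 i j k z : A z ->
  dy k (fun w => metric F w i j) z = dy k (fun w => metric F w j i) z.
Proof.
by move=> Az; apply: (dy_congr _ _ oA) => // w; exact: metricF_sym.
Qed.

(** Exchanging [k] and [i] is the symmetry of the Hessian of the degree 1 function [dy j (sq F)]. *)
Lemma dy_metric_sym13 i j k z : A z ->
  dy k (fun w => metric F w i j) z = dy i (fun w => metric F w k j) z.
Proof.
move=> Az.
have [s1 h1] := sh_dy _ _ oA coneA 2 _ j (sh_sq _ _ coneA _ shF).
have D l l' : dy l (fun w => metric F w l' j) z =
    2^-1 * dy l (dy l' (dy j (sq F))) z.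
  rewrite -(dyZ _ _ oA _ _ l z (smooth_dy _ _ oA l' _ s1) Az).
  by apply: (dy_congr _ _ oA) => // w _; rewrite mxE.
by rewrite (D k i) (D i k)
  (hessian_sym _ _ oA coneA A_neq0 _ _ k i z s1 h1 Az).
Qed.

Lemma dy_metric_y i j z : A z ->
  yc 0 z * dy 0 (fun w => metric F w i j) z
  + yc 1 z * dy 1 (fun w => metric F w i j) z = 0.
Proof.
move=> Az; have [sg hg] := sh_metric _ _ oA coneA F i j shF.
by rewrite (euler _ _ oA 0 _ z sg hg Az) mul0r.
Qed.

(** The y-derivative of g is totally symmetric and annihilated by y, hence a multiple of n_i n_j
    n_k; so the set from which [xget] chooses is inhabited. *)
Lemma main_scalarP z : A z -> forall i j k,
  F z * cartan F i j k z =
  main_scalar F z * m_lo F i z * m_lo F j z * m_lo F k z.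
Proof.
move=> Az.
have [c cP] := sym_kernel_perp3 _ _ _ (yc_neq0 _ _ A_neq0 z Az)
  (fun i j k => dy k (fun w => metric F w i j) z)
  (fun i j k => dy_metric_sym12 i j k z Az)
  (fun i j k => dy_metric_sym13 i j k z Az)
  (fun i j => dy_metric_y i j z Az).
have s0 : s z != 0 by rewrite gt_eqF // s_gt0.
have f0 := F_neq0 z Az.
rewrite /main_scalar; case: xgetP => [x _ //|].
(* The witness solves F c / 2 = I (s / F)^3, as m_i = (s / F) n_i. *)
move=> /(_ (F z ^+ 4 * c / (2 * s z ^+ 3))) [] i j k.
rewrite /cartan cP (m_loE i) (m_loE j) (m_loE k).
generalize (perp _ (yc 0 z) (yc 1 z) i) (perp _ (yc 0 z) (yc 1 z) j)
  (perp _ (yc 0 z) (yc 1 z) k) => p q r.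
by move: s0 f0; generalize (s z) (F z) => t f t0 f0; field; rewrite t0 f0.
Qed.

Lemma dy_metricE i j k z : A z -> dy k (fun w => metric F w i j) z =
  2 * main_scalar F z * s z ^+ 3 / F z ^+ 4 * n z i * n z j * n z k.
Proof.
move=> Az; have := main_scalarP z Az i j k.
rewrite /cartan (m_loE i) (m_loE j) (m_loE k).
have f0 := F_neq0 z Az.
generalize (perp _ (yc 0 z) (yc 1 z) i) (perp _ (yc 0 z) (yc 1 z) j)
  (perp _ (yc 0 z) (yc 1 z) k) (main_scalar F z)
  (dy k (fun w => metric F w i j) z) => p q r I T.
move: f0; generalize (s z) (F z) => t f f0 E.
have -> : T = 2 / f * (f * (2^-1 * T)) by field.
by rewrite E; field.
Qed.

(** The last factor is g_ij y^i y^j: the product rule contracts n_i n_j with the adjugate of g. *)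
Lemma dy_detE k z : A z -> dy k (fun w => \det (metric F w)) z =
  2 * main_scalar F z * s z ^+ 3 / F z ^+ 4 * n z k *
  (yc 1 z ^+ 2 * metric F z 1 1 + yc 0 z ^+ 2 * metric F z 0 0
   + 2 * (yc 0 z * yc 1 z) * metric F z 0 1).
Proof.
move=> Az.
have sg i j : smooth (fun w => metric F w i j).
  by have [] := sh_metric _ _ oA coneA F i j shF.
have s01 := smooth_closure_mul _ _ _ (sg 0 1) (sg 0 1).
rewrite (dy_congr _ _ oA _ (fun w => metric F w 0 0 * metric F w 1 1 +
  (- 1) * (metric F w 0 1 * metric F w 0 1)) k z Az); last first.
  by move=> w Aw; rewrite det_mx2 (metricF_sym 1 0 w Aw) mulN1r.
rewrite (dyD _ _ oA _ _ k z (smooth_closure_mul _ _ _ (sg 0 0) (sg 1 1))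
  (smooth_closure_mul _ _ _ (smooth_closure_cst A (-1)) s01) Az).
rewrite (dyZ _ _ oA _ _ k z s01 Az) (dyM _ _ oA _ _ k z (sg 0 1) (sg 0 1) Az).
rewrite (dyM _ _ oA _ _ k z (sg 0 0) (sg 1 1) Az).
rewrite (dy_metricE 0 0 k z Az) (dy_metricE 0 1 k z Az) (dy_metricE 1 1 k z Az).
have -> : perp _ (yc 0 z) (yc 1 z) 0 = - yc 1 z by [].
have -> : perp _ (yc 0 z) (yc 1 z) 1 = yc 0 z by [].
generalize (metric F z 0 0) (metric F z 0 1) (metric F z 1 1)
  (perp _ (yc 0 z) (yc 1 z) k) (yc 0 z) (yc 1 z)
  (2 * main_scalar F z * s z ^+ 3 / F z ^+ 4) => a b c p y0 y1 q; ring.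
Qed.

(** The Hessian is some multiple k of n_i n_j. Inserting this into g_ij = F_i F_j + F F_ij gives det
    g = F k (y^i F_i)^2 = F^3 k, which determines k. *)
Lemma hessF_perp z : A z -> forall i j, dy i (dy j F) z =
  eps z * s z ^+ 2 / F z ^+ 3 * n z i * n z j.
Proof.
move=> Az.
have [k kP] := sym_kernel_perp2 _ _ _ (yc_neq0 _ _ A_neq0 z Az)
  (fun i j => dy i (dy j F) z) (fun i j => hessF_sym i j z Az)
  (fun j => hessF_y j z Az).
have {}kP i j : dy i (dy j F) z = k * n z i * n z j := kP i j.
move=> i j; rewrite kP -(det_s z Az) det_mx2; congr (_ * _ * _).
rewrite (metricFE 0 0 z Az) (metricFE 0 1 z Az) (metricFE 1 0 z Az).
rewrite (metricFE 1 1 z Az).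
have K00 := kP 0 0; have K01 := kP 0 1; have K10 := kP 1 0; have K11 := kP 1 1.
have p0 : perp _ (yc 0 z) (yc 1 z) 0 = - yc 1 z by [].
have p1 : perp _ (yc 0 z) (yc 1 z) 1 = yc 0 z by [].
rewrite p0 p1 in K00 K01 K10 K11.
have f0 := F_neq0 z Az; have E := eulerF z Az.
move: f0 E K00 K01 K10 K11; generalize (dy 0 (dy 0 F) z) (dy 0 (dy 1 F) z)
  (dy 1 (dy 0 F) z) (dy 1 (dy 1 F) z) (dy 0 F z) (dy 1 F z) (F z)
  (yc 0 z) (yc 1 z) => ? ? ? ? a b f y0 y1 f0 E -> -> -> ->.
have -> : (a * a + f * (k * - y1 * - y1)) * (b * b + f * (k * y0 * y0)) -
    (a * b + f * (k * - y1 * y0)) * (b * a + f * (k * y0 * - y1)) =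
    f * k * (y0 * a + y1 * b) ^+ 2 by ring.
by rewrite -E; field.
Qed.

(** * The conformal factor and the determinant of the changed metric *)

Variable phi : TR2 -> R.
Hypothesis shphi : sh 0 phi.

Let smphi : smooth phi. Proof. by case: shphi. Qed.
Let hophi : hom 0 phi. Proof. by case: shphi. Qed.

Lemma hessphi_sym i j z : A z -> dy i (dy j phi) z = dy j (dy i phi) z.
Proof. exact: (hessian_sym _ _ oA coneA A_neq0 0 phi i j z smphi hophi). Qed.

(** As phi has degree 0, its Hessian contracted with y is -phi_j = -l n_j. The added term in
    [l / F z] contracts to l n_j, since y^i F_i = F and y^i n_i = 0, so the sum is annihilated by
    y. *)
Lemma phi_perp z : A z -> exists l u : R,
  (forall i, dy i phi z = l * n z i) /\
  (forall i j, dy i (dy j phi) z = u * n z i * n z j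
     - l / F z * (n z i * dy j F z + n z j * dy i F z)).
Proof.
move=> Az; have y0 := yc_neq0 _ _ A_neq0 z Az.
have [w wP] := kernel_line _ _ _ y0.
have E0 : yc 0 z * dy 0 phi z + yc 1 z * dy 1 phi z = 0.
  by rewrite (euler _ _ oA 0 phi z smphi hophi Az) mul0r.
have := wP (fun i => dy i phi z) E0.
move: (w 0 * _ + w 1 * _) => l lP.
have [i j|j|u uP] := sym_kernel_perp2 _ _ _ y0
  (fun i j => dy i (dy j phi) z +
     l / F z * (n z i * dy j F z + n z j * dy i F z)).
- rewrite (hessphi_sym i j z Az).
  by generalize (dy i F z) (dy j F z) (dy j (dy i phi) z) (l / F z)
    (perp _ (yc 0 z) (yc 1 z) i) (perp _ (yc 0 z) (yc 1 z) j)
    => a b c d p q; ring.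
- have E := euler_hessian _ _ oA coneA 0 phi j z smphi hophi Az.
  rewrite sub0r mulrN1z mulN1r lP in E.
  have EF := eulerF z Az; have f0 := F_neq0 z Az.
  have N : yc 0 z * n z 0 + yc 1 z * n z 1 = 0 by rewrite /perp /=; ring.
  have alg (f y0' y1 a b c g0 g1 n0 n1 m h0 h1 : R) : f != 0 ->
      f = y0' * a + y1 * b -> y0' * n0 + y1 * n1 = 0 ->
      y0' * h0 + y1 * h1 = - (l * m) ->
      y0' * (h0 + l / f * (n0 * c + m * a))
      + y1 * (h1 + l / f * (n1 * c + m * b)) = 0.
    move=> f0' Ef En Eh; transitivity ((y0' * h0 + y1 * h1) +
      l / f * ((y0' * n0 + y1 * n1) * c + m * (y0' * a + y1 * b))); first by ring.
    by rewrite En -Ef Eh; field.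
  exact: (alg _ _ _ _ _ _ 0 0 _ _ _ _ _ f0 EF N E).
by exists l, u; split=> // i j; rewrite -uP addrK.
Qed.

Lemma det_metric_conformal z : A z ->
  \det (metric (fun w => expR (phi w) * F w) z) =
  expR (phi z) ^+ 4 * s z ^+ 2 *
  (sigma F phi z + eps z - d2 F phi z ^+ 2).
Proof.
move=> Az.
have s0 : s z != 0 by rewrite gt_eqF // s_gt0.
have f0 := F_neq0 z Az.
have sdF k := smooth_dy _ _ oA k F smF.
have sdp k := smooth_dy _ _ oA k phi smphi.
have [l [u [lP uP]]] := phi_perp z Az.
have HF := hessF_perp z Az.
have p0 : perp _ (yc 0 z) (yc 1 z) 0 = - yc 1 z by [].
have p1 : perp _ (yc 0 z) (yc 1 z) 1 = yc 0 z by [].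
(* Differentiates the expression of [d2E], valid on all of [A], where the signature has been
   absorbed into [s]. *)
have DP k : dy k (d2 F phi) z =
  (dy k F z / s z - F z * (eps z * dy k (fun w => \det (metric F w)) z
     / (2 * s z)) / s z ^+ 2) * (dy 0 F z * dy 1 phi z - dy 1 F z * dy 0 phi z)
  + F z / s z * (dy k (dy 0 F) z * dy 1 phi z + dy 0 F z * dy k (dy 1 phi) z
     - (dy k (dy 1 F) z * dy 0 phi z + dy 1 F z * dy k (dy 0 phi) z)).
  apply: dy_val.
  have DD f : smooth f -> is_derive z ((0, delta_mx 0 k) : TR2) f (dy k f z).
    move=> sf; exact: (is_derive_dy _ _ oA k f z sf Az).
  have Ds := is_derive_invf _ _ _ _ s0 (is_derive_s k z Az).
  have DFs := is_derive_mulf _ _ _ _ _ _ (DD _ smF) Ds.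
  have DQ1 := is_derive_mulf _ _ _ _ _ _ (DD _ (sdF 0)) (DD _ (sdp 1)).
  have DQ2 := is_derive_mulf _ _ _ _ _ _ (DD _ (sdF 1)) (DD _ (sdp 0)).
  have DQ3 := is_derive_mulf _ _ _ _ _ _ (is_derive_cst (-1 : R) z _) DQ2.
  have DQ := is_derive_addf _ _ _ _ _ _ DQ1 DQ3.
  have DP := is_derive_mulf _ _ _ _ _ _ DFs DQ.
  have := is_derive_on A _ (d2 F phi) _ _ _ oA Az _ DP.
  move=> /(_ _) D; apply: is_derive_eq (D _) _.
    by move=> w Aw; rewrite (d2E phi w Aw) mulN1r.
  rewrite /cst.
  move: s0; generalize (dy k (fun w => \det (metric F w)) z) (s z) (F z) (eps z)
    (dy k F z) (dy 0 F z) (dy 1 F z) (dy 0 phi z) (dy 1 phi z)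
    (dy k (dy 0 F) z) (dy k (dy 1 F) z) (dy k (dy 0 phi) z) (dy k (dy 1 phi) z).
  by move=> d t f e a b c p q a' b' p' q' t0; field.
have EP := d2E phi z Az.
have EPP := d2E (d2 F phi) z Az.
have E00 := HF 0 0; have E01 := HF 0 1; have E11 := HF 1 1.
have U00 := uP 0 0; have U01 := uP 0 1; have U11 := uP 1 1.
have L0 := lP 0; have L1 := lP 1.
have DP0 := DP 0; have DP1 := DP 1.
have SF := hessF_sym 1 0 z Az; have Sp := hessphi_sym 1 0 z Az.
have G0 := dy_detE 0 z Az; have G1 := dy_detE 1 z Az.
rewrite (metricFE 0 0 z Az) (metricFE 0 1 z Az) (metricFE 1 1 z Az) in G0 G1.
rewrite p0 p1 in E00 E01 E11 U00 U01 U11 L0 L1 G0 G1.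
have EF := eulerF z Az.
rewrite det_mx2.
rewrite (metric_conformal _ _ oA F phi 0 0 z smF smphi Az).
rewrite (metric_conformal _ _ oA F phi 0 1 z smF smphi Az).
rewrite (metric_conformal _ _ oA F phi 1 0 z smF smphi Az).
rewrite (metric_conformal _ _ oA F phi 1 1 z smF smphi Az).
rewrite /sigma.
move: SF Sp EF f0 s0 E00 E01 E11 U00 U01 U11 L0 L1 G0 G1 DP0 DP1 EP EPP.
generalize (dy 0 (d2 F phi) z) (dy 1 (d2 F phi) z) (d2 F (d2 F phi) z)
  (d2 F phi z) (dy 0 (fun w => \det (metric F w)) z)
  (dy 1 (fun w => \det (metric F w)) z) (main_scalar F z)
  (dy 1 (dy 0 F) z) (dy 1 (dy 0 phi) z)
  (dy 0 (dy 0 F) z) (dy 0 (dy 1 F) z) (dy 1 (dy 1 F) z)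
  (dy 0 (dy 0 phi) z) (dy 0 (dy 1 phi) z) (dy 1 (dy 1 phi) z)
  (dy 0 F z) (dy 1 F z) (dy 0 phi z) (dy 1 phi z)
  (yc 0 z) (yc 1 z) (F z) (s z) (eps z) (expR (phi z)).
clear; move=> P0 P1 PP P d0 d1 I F10 p10 F00 F01 F11 p00 p01 p11 F0 F1 p0 p1 y0 y1 f t e x.
move=> -> -> EF f0 t0 E00 E01 E11 U00 U01 U11 L0 L1 G0 G1 DP0 DP1 EP EPP.
have two0 : (2 : R) != 0 by rewrite pnatr_eq0.
have ID := conformal_det_identity _ f y0 y1 F0 F1 t e I l u F00 F01 F11
  p0 p1 p00 p01 p11 d0 d1 (e * d0 / (2 * t)) (e * d1 / (2 * t)) P P0 P1 PP
  EF f0 t0 two0.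
have {}ID := ID _ _ _ _ _ _ _ _ _ _ erefl erefl EP DP0 DP1 EPP.
(* Each metric entry carries e^(2 phi), whence e^(4 phi) in the determinant. The remaining goals are
   the normal forms assumed by the identity. *)
rewrite -[RHS]mulrA -ID; first by ring.
- by rewrite E00; ring.
- by rewrite E01; ring.
- by rewrite E11; ring.
- by rewrite L0; ring.
- by rewrite L1; ring.
- by rewrite U00; ring.
- by rewrite U01; ring.
- by rewrite U11; ring.
- by rewrite G0; ring.
- by rewrite G1; ring.
Qed.

End FinslerFrame.

(** * Passing between spray, Barthel and Berwald coefficients *)

Section Sprays.
Variable R : realType.
Local Notation TR2 := ('rV[R]_2 * 'rV[R]_2)%type.
Variable A : set TR2.
Hypothesis oA : open A.
Hypothesis coneA : forall z (t : R), A z -> 0 < t -> A (z.1, t *: z.2).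

Lemma equiv_spray_connections (G H : 'I_2 -> TR2 -> R) :
  (forall i, smooth_hom R A 2 (G i)) -> (forall i, smooth_hom R A 2 (H i)) ->
  ((forall z, A z -> forall i, G i z = H i z) <->
   (forall z, A z -> forall i j, dy j (G i) z = dy j (H i) z)) /\
  ((forall z, A z -> forall i j, dy j (G i) z = dy j (H i) z) <->
   (forall z, A z -> forall i j k,
      dy k (dy j (G i)) z = dy k (dy j (H i)) z)).
Proof.
move=> sG sH; split; split=> E z Az.
- by move=> i j; apply: (dy_congr _ _ oA) => // w Aw; exact: E.
- move=> i; apply: (sh_dy_inj _ _ oA 2 (G i) (H i)) Az => // w Aw j.
  exact: E.
- by move=> i j k; apply: (dy_congr _ _ oA) => // w Aw; exact: E.
(* One y-derivative lowers the degree from 2 to 1, which is still nonzero, so Euler's theorem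
   applies again. *)
- move=> i j; apply: (sh_dy_inj _ _ oA (2 - 1) (dy j (G i)) (dy j (H i))) Az.
  + exact: sh_dy.
  + exact: sh_dy.
  + by [].
  + by move=> w Aw k; exact: E.
Qed.
End Sprays.

(** * From the tangent bundle to induced coordinates *)

Section LocalDomain.
Variables (R : realType) (M : surface R) (A : set (tangent M)) (a : chart M).

Lemma tpoint_scale (z : 'rV[R]_2 * 'rV[R]_2) (t : R) :
  tpoint a (z.1, t *: z.2) = tscale t (tpoint a z).
Proof. by rewrite /tpoint /tscale /= linearZ. Qed.

Lemma local_dom_scale (z : 'rV[R]_2 * 'rV[R]_2) (t : R) :
  conic_subbundle A -> local_dom A a z -> 0 < t ->
  local_dom A a (z.1, t *: z.2).
Proof.
by move=> [_ _ _ _ cA] [z1 Az] t0; split; rewrite // tpoint_scale; exact: cA.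
Qed.

(** The differential of a transition map is linear, so zero components in the chart [a] would
    represent the zero tangent vector. *)
Lemma local_dom_neq0 z : conic_subbundle A -> local_dom A a z -> z.2 != 0.
Proof.
move=> [_ _ A0 _ _] [_ /A0]; apply: contra => /eqP z0.
by rewrite /tpoint /= z0 linear0.
Qed.

Lemma sh_local (k : nat) f : tsmooth A f -> homogeneous k A f ->
  smooth_hom R (local_dom A a) k (local f a).
Proof.
move=> sf hf; split; first exact: smooth_closure_base (sf a).
by move=> z t [_ Az] t0; rewrite /local /= tpoint_scale hf.
Qed.
End LocalDomain.

Theorem proposition3p13 (R : realType) (M : surface R)
    (A : set (tangent M)) (F phi : tangent M -> R)
    (HF : conic_pseudo_Finsler A F)
    (F_neq0 : forall u, A u -> F u != 0)
    (phi_smooth : tsmooth A phi)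
    (phi_homogeneous : homogeneous 0 A phi)
    (Hsigma : forall (a : chart M) z, local_dom A a z ->
       sigma (local F a) (local phi a) z + signature (local F a) z
         - d2 (local F a) (local phi a) z ^+ 2 != 0)
    (a : chart M) :
  let Fa := local F a in
  let Fbar := local (conformal_change F phi) a in
  let D := local_dom A a in
  ((forall z, D z -> forall i, spray Fbar i z = spray Fa i z) <->
   (forall z, D z -> forall i j, barthel Fbar i j z = barthel Fa i j z)) /\
  ((forall z, D z -> forall i j, barthel Fbar i j z = barthel Fa i j z) <->
   (forall z, D z -> forall i j k, berwald Fbar i j k z = berwald Fa i j k z)).
Proof.
move=> Fa Fbar D; case: HF => cA sF hF dF.
have oD : open D by case: cA => _ oA _ _ _; exact: oA.
have coneD z (t : R) : D z -> 0 < t -> D (z.1, t *: z.2).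
  exact: (local_dom_scale _ _ _ _ z t cA).
have D0 z : D z -> z.2 != 0 by exact: (local_dom_neq0 _ _ _ _ z cA).
have shF : smooth_hom R D 1 Fa by exact: (sh_local _ _ _ a 1).
have shp : smooth_hom R D 0 (local phi a) by exact: (sh_local _ _ _ a 0).
have Fa0 z : D z -> Fa z != 0 by move=> [_ Az]; exact: F_neq0.
have dFa z : D z -> \det (metric Fa z) != 0 by exact: dF.
have shFbar : smooth_hom R D 1 Fbar.
  exact: (sh_mul _ _ 0 1 _ _ (sh_exp _ _ _ shp) shF).
(* This makes the spray of [Fbar] smooth. The determinant is a product of powers of positive numbers
   and the quantity that [Hsigma] keeps away from 0. *)
have dFbar z : D z -> \det (metric Fbar z) != 0.
  move=> Dz.
  have -> := det_metric_conformal _ _ oD coneD D0 _ shF Fa0 dFa _ shp z Dz.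
  rewrite mulf_neq0 ?Hsigma // mulf_neq0 ?expf_neq0 ?gt_eqF ?expR_gt0 //.
  exact: (s_gt0 _ _ _ dFa).
apply: (equiv_spray_connections _ _ oD coneD (spray Fbar) (spray Fa)) => i.
  exact: sh_spray.
exact: sh_spray.
Qed.
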